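(* Let $q$ be a prime power, let $h,n,k$ be positive integers, and let $\mathcal C\subseteq\mathbb F_{q^h}^n$ be a nondegenerate additive code of $\mathbb F_q$-dimension $k$. For $i\in[n]$ let $\rho_i:=\dim_{\mathbb F_q}\{c_i:c\in\mathcal C\}$, and let $\rho_{\min}:=\min_i\rho_i$ and $w_{\max}(\mathcal C):=\max_{c\in\mathcal C}\operatorname{wt}(c)$. Let $t_0:=\min\{t\ge1:\ \sum_{i=1}^nq^{-t\rho_i}<1\}$ (minimum over integers $t$). Then $$\left\lceil\frac{n}{w_{\max}(\mathcal C)}\right\rceil\le\operatorname{crit}(\mathcal C)\le\min\{k-\rho_{\min}+1,\ t_0\}\le\min\left\{k-\rho_{\min}+1,\ \left\lfloor\frac{\log_qn}{\rho_{\min}}\right\rfloor+1\right\}.$$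
   Context: An additive code $\mathcal C\subseteq\mathbb F_{q^h}^n$ is an $\mathbb F_q$-linear subspace. It is nondegenerate if for every $i\in[n]=\{1,\ldots,n\}$ the coordinate map $\mathcal C\to\mathbb F_{q^h}$, $c\mapsto c_i$, is nonzero. For $c\in\mathcal C$, $\operatorname{supp}(c)=\{i\in[n]:c_i\ne0\}$ and $\operatorname{wt}(c)=|\operatorname{supp}(c)|$. For an $\mathbb F_q$-subspace $\mathcal D\subseteq\mathcal C$ let $\operatorname{supp}(\mathcal D)=\bigcup_{c\in\mathcal D}\operatorname{supp}(c)$; $\operatorname{crit}(\mathcal C)$ is the minimum of $\dim_{\mathbb F_q}\mathcal D$ over all $\mathbb F_q$-subspaces $\mathcal D\subseteq\mathcal C$ with $\operatorname{supp}(\mathcal D)=[n]$. *)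

(* Defs.v *)
From HB Require Import structures.
From mathcomp Require Import all_boot all_order all_algebra all_field.
From mathcomp Require Import reals exp.

Set Implicit Arguments.
Unset Strict Implicit.
Unset Printing Implicit Defensive.

Import Order.TTheory GRing.Theory Num.Theory.

Local Open Scope ring_scope.

(* A vector space over a finite field has finitely many subspaces, so that one
   can minimize over all of them. *)
Section VspaceFinite.
Variables (F : finFieldType) (V : vectType F).

HB.instance Definition _ := isCountable.Build (@space F V)
  (pcan_pickleK (can_pcan (@VectorInternalTheory.vs2mxK F V))).
HB.instance Definition _ := isFinite.Build (@space F V)
  (pcan_enumP (can_pcan (@VectorInternalTheory.vs2mxK F V))).

End VspaceFinite.

(* The ambient space L^n as a vector space over F only; [finvect_type L] is L
   with the finType structure it has as a finite extension of the finite field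
   F. *)
Notation ambient L n := {ffun 'I_n -> finvect_type L}.

Section AdditiveCodes.
Variables (F : finFieldType) (L : fieldExtType F) (n : nat).
Implicit Types (c : ambient L n) (C D : {vspace ambient L n}) (i : 'I_n).

Definition coordmap i c : finvect_type L := c i.

Fact coordmap_is_linear i : linear (coordmap i).
Proof. by move=> a u v; rewrite /coordmap !ffunE. Qed.
HB.instance Definition _ i :=
  GRing.isLinear.Build F (ambient L n) (finvect_type L) _ (coordmap i)
    (coordmap_is_linear i).

Definition nondegenerate_code C : Prop :=
  forall i, exists2 c, c \in C & coordmap i c != 0.

Definition supp c : {set 'I_n} := [set i | c i != 0].

Definition wt c : nat := #|supp c|.

Definition suppv D : {set 'I_n} := \bigcup_(c in D) supp c.

Definition wmax C : nat := \max_(c in C) wt c.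

Definition rho C i : nat := \dim (linfun (coordmap i) @: C)%VS.

(* The neutral value \dim C is >= every [rho C i] (see [rho_le_dim]), hence this
   is the minimum of the [rho C i] as soon as 0 < n. *)
Definition rho_min C : nat := \big[minn/(\dim C)]_(i < n) rho C i.

(* C itself is the starting point of the minimization; it is admissible exactly
   when C is nondegenerate (see [suppv_nondegenerate]). *)
Definition crit C : nat :=
  \dim [arg min_(D < C | (D <= C)%VS && (suppv D == setT)) \dim D]%N.

Lemma rho_le_dim C i : (rho C i <= \dim C)%N.
Proof. by rewrite -(limg_ker_dim (linfun (coordmap i)) C) leq_addl. Qed.

Lemma suppv_nondegenerate C : nondegenerate_code C -> suppv C = [set: 'I_n].
Proof.
move=> nd; apply/setP=> i; rewrite in_setT; have [c cC ci0] := nd i.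
by apply/bigcupP; exists c => //; rewrite inE.
Qed.

Lemma rho_gt0 C i : nondegenerate_code C -> (0 < rho C i)%N.
Proof.
move=> nd; have [c cC ci0] := nd i.
rewrite lt0n dimv_eq0; apply: contraNneq ci0 => im0.
by rewrite -memv0 -im0 -(lfunE (coordmap i)) memv_img.
Qed.

Definition t0_pred C (t : nat) : bool :=
  (1 <= t)%N && (\sum_(i < n) (#|F|%:R : rat) ^- (t * rho C i) < 1).

Lemma t0_exists C : nondegenerate_code C -> exists t, t0_pred C t.
Proof.
move=> nd; exists n.+1; rewrite /t0_pred /=.
have q2 : (1 < #|F|)%N := finNzRing_gt1 F.
have le i : (#|F|%:R : rat) ^- (n.+1 * rho C i) <= (2 ^ n.+1)%:R^-1.
  rewrite -natrX lef_pV2 ?posrE ?ltr0n ?expn_gt0 ?(ltnW q2) // ler_nat.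
  apply: leq_trans (_ : #|F| ^ n.+1 <= _)%N; first by rewrite leq_exp2r.
  by rewrite leq_exp2l // leq_pmulr // rho_gt0.
apply: le_lt_trans (ler_sum _ (fun i _ => le i)) _.
rewrite sumr_const card_ord -[X in X < _]mulr_natl ltr_pdivrMr ?ltr0n ?expn_gt0 //.
by rewrite mul1r ltr_nat (ltn_trans (ltnSn n)) // ltn_expl.
Qed.

Definition t0 C (nd : nondegenerate_code C) : nat := ex_minn (t0_exists nd).

End AdditiveCodes.

Definition log_base (R : realType) (b x : R) : R := ln x / ln b.

(* Main.v *)
Require Import Defs.
From mathcomp Require Import all_boot all_order all_algebra all_field.
From mathcomp Require Import reals exp.
From mathcomp Require Import zify.

Import Order.TTheory GRing.Theory Num.Theory.

Local Open Scope ring_scope.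

(** The codewords of [C] vanishing at position [i] form a subspace [ker i] of
    dimension [k - rho_i], and a subspace [D] of [C] has full support exactly
    when it lies in no [ker i].
    Lower bound: the support of [D] is covered by the supports of the vectors
    of a basis of [D], each of size at most [wmax].
    Upper bound [k - rho_min + 1]: a subspace of that dimension is too large to
    lie in any [ker i].
    Upper bound [t_0]: among the [q^(kt)] tuples of [t] codewords, at most
    [\sum_i q^((k - rho_i) t)] lie entirely in some [ker i]; when
    [\sum_i q^(- t rho_i) < 1] some tuple lies in none, and its span has full
    support and dimension at most [t].
    The last inequality holds because [n < q^(t rho_min)] already forces
    [\sum_i q^(- t rho_i) < 1]. *)

Section Support.
Set Implicit Arguments.
Unset Strict Implicit.
Variables (F : finFieldType) (L : fieldExtType F) (n : nat).
Implicit Types (C D : {vspace ambient L n}) (i : 'I_n).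

Let ker i := lker (linfun (@coordmap F L n i)).

Lemma mem_coord_ker i c : (c \in ker i) = (c i == 0).
Proof. by rewrite memv_ker lfunE. Qed.

Lemma dim_coord_ker C i : (\dim (C :&: ker i) = \dim C - rho C i)%N.
Proof. by rewrite -(limg_ker_dim (linfun (coordmap i)) C) addnK. Qed.

Lemma in_suppv D i : (i \in suppv D) = ~~ (D <= ker i)%VS.
Proof.
apply/bigcupP/subvPn => -[c cD ci]; exists c => //.
  by rewrite mem_coord_ker; rewrite inE in ci.
by rewrite inE -mem_coord_ker.
Qed.

(** A span lies in the subspace [ker i] as soon as its generators do. *)
Lemma in_suppv_span (X : seq (ambient L n)) i :
  (i \in suppv <<X>>%VS) = has (fun c => i \in supp c) X.
Proof.
rewrite in_suppv -[RHS]negbK -all_predC; congr (~~ _).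
apply/span_subvP/allP => XK c /XK /=.
  by rewrite mem_coord_ker inE negbK.
by rewrite mem_coord_ker inE negbK.
Qed.

Lemma card_suppv_span (X : seq (ambient L n)) :
  (#|suppv <<X>>%VS| <= \sum_(c <- X) wt c)%N.
Proof.
elim: X => [|c X IHX].
  rewrite big_nil leqn0 cards_eq0; apply/eqP/setP => i.
  by rewrite in_suppv_span inE.
rewrite big_cons; apply: leq_trans (leq_add (leqnn _) IHX).
apply: leq_trans (leq_card_setU _ _); apply: subset_leq_card.
by apply/subsetP => i; rewrite in_setU !in_suppv_span.
Qed.

Lemma card_suppv_le C D : (D <= C)%VS -> (#|suppv D| <= \dim D * wmax C)%N.
Proof.
move=> DC; rewrite -{1}(span_basis (vbasisP D)).
apply: leq_trans (card_suppv_span _) _.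
rewrite -{2}(size_tuple (vbasis D)) mulnC -iter_addn_0 -count_predT.
rewrite -big_const_seq big_seq [X in (_ <= X)%N]big_seq.
apply: leq_sum => c /vbasis_mem/(subvP DC); exact: (@leq_bigmax_cond _ (mem C)).
Qed.

Lemma suppv_full_dim C D :
    (D <= C)%VS -> (forall i, \dim C - rho C i < \dim D)%N ->
  suppv D = setT.
Proof.
move=> DC ltD; apply/setP => i; rewrite in_setT in_suppv.
apply: contraL (ltD i) => DK; rewrite -leqNgt -dim_coord_ker.
by rewrite dimvS // subv_cap DC.
Qed.

Lemma suppv_full_tuple C (t : nat) :
    (\sum_(i < n) #|F| ^ ((\dim C - rho C i) * t) < #|F| ^ (\dim C * t))%N ->
  exists2 X : t.-tuple (ambient L n),
    {subset X <= C} & suppv <<X>>%VS = setT.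
Proof.
move=> lt_bad.
(* [bad i] holds the tuples of codewords that all vanish at [i]; the union bound shows that these
   sets cannot exhaust [tuplesC]. *)
pose bad i : {set {ffun 'I_t -> ambient L n}} :=
  [set f in ffun_on (mem (C :&: ker i)%VS)].
pose tuplesC : {set {ffun 'I_t -> ambient L n}} := [set f in ffun_on (mem C)].
have card_bad : (#|\bigcup_i bad i| < #|tuplesC|)%N.
  have -> : #|tuplesC| = (#|F| ^ (\dim C * t))%N.
    by rewrite cardsE card_ffun_on card_ord card_vspace expnM.
  apply: leq_ltn_trans lt_bad; elim/big_ind2: _ => [|a A b B leA leB|i _].
  - by rewrite cards0.
  - by apply: leq_trans (leq_card_setU A B) (leq_add leA leB).
  - by rewrite cardsE card_ffun_on card_ord card_vspace dim_coord_ker expnM.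
have /subsetPn[f] : ~~ (tuplesC \subset \bigcup_i bad i).
  by apply: contraL card_bad => /subset_leq_card; rewrite -leqNgt.
rewrite inE => /ffun_onP fC /bigcupP f_good.
exists [tuple f j | j < t].
  by move=> c /mapP[j _ ->]; apply: fC.
apply/setP => i; rewrite in_setT in_suppv; apply/negP => fK.
case: f_good; exists i => //; rewrite inE; apply/ffun_onP => j.
rewrite memv_cap fC (subvP fK) // memv_span //.
by apply: map_f; rewrite mem_enum.
Qed.

End Support.

Section Critical.
Set Implicit Arguments.
Unset Strict Implicit.
Variables (F : finFieldType) (L : fieldExtType F) (n : nat).
Variables (C : {vspace ambient L n}) (nd : nondegenerate_code C).

Let C_admissible : (C <= C)%VS && (suppv C == setT).
Proof. by rewrite subvv suppv_nondegenerate /=. Qed.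

Lemma crit_attained :
  exists D, [/\ (D <= C)%VS, suppv D = setT & crit C = \dim D].
Proof.
rewrite /crit; case: arg_minnP => // D /andP[DC /eqP sD] _.
by exists D.
Qed.

Lemma crit_le D : (D <= C)%VS -> suppv D = setT -> (crit C <= \dim D)%N.
Proof.
move=> DC sD; rewrite /crit; case: arg_minnP => // E _; apply.
by rewrite DC sD /=.
Qed.

(* [minn] is convertible to [Order.min] on [nat], so the order-theoretic
   [\big[Order.min/_]] lemmas apply. *)
Lemma rho_min_le i : (rho_min C <= rho C i)%N.
Proof. exact: (@bigmin_le_cond _ nat _ _ _ xpredT). Qed.

Lemma rho_min_gt0 : (0 < n)%N -> (0 < rho_min C)%N.
Proof.
move=> n_gt0; apply: (big_ind (fun m => 0 < m)%N) => [|a b a0 b0|i _].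
(* The default value [\dim C] of the minimum must be positive too; it dominates [rho C] at the first
   position. *)
- by apply: leq_trans (rho_le_dim C (Ordinal n_gt0)); apply: rho_gt0.
- by rewrite leq_min a0.
- exact: rho_gt0.
Qed.

Lemma rho_min_le_dim : (0 < n)%N -> (rho_min C <= \dim C)%N.
Proof.
by move=> n_gt0; apply: leq_trans (rho_min_le (Ordinal n_gt0)) (rho_le_dim _ _).
Qed.

Lemma length_le_crit : (n <= crit C * wmax C)%N.
Proof.
have [D [DC sD ->]] := crit_attained.
by have := card_suppv_le DC; rewrite sD cardsT card_ord.
Qed.

Lemma crit_le_dim : (0 < n)%N -> (crit C <= \dim C - rho_min C + 1)%N.
Proof.
move=> n_gt0; have r0 := rho_min_gt0 n_gt0; have rk := rho_min_le_dim n_gt0.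
(* Since [rho_min C] is at least 1, a basis of [C] has [m] vectors to take. *)
set m := (_ + 1)%N; have mk : (m <= \dim C)%N by lia.
pose X := take m (vbasis C).
have freeX : free X.
  have := basis_free (vbasisP C).
  by rewrite -[X in free X -> _](cat_take_drop m); apply: catl_free.
have dimX : \dim <<X>> = m.
  by rewrite (eqP freeX) size_takel // size_tuple.
have XC : (<<X>> <= C)%VS.
  by apply/span_subvP => c /mem_take; apply: vbasis_mem.
rewrite -dimX; apply: (crit_le XC); apply: (suppv_full_dim XC) => i.
by rewrite dimX /m; have := rho_min_le i; lia.
Qed.

Lemma crit_le_t0 : (crit C <= t0 nd)%N.
Proof.
rewrite /t0; case: ex_minnP => t /andP[_ lt1] _.
have q0 : (0 : rat) < #|F|%:R by rewrite ltr0n (ltnW (finNzRing_gt1 F)).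
have [|X XC sX] := @suppv_full_tuple F L n C t.
  rewrite -(ltr_nat rat) natr_sum natrX.
  (* Dividing by [q^(k t)] leaves the terms [q^(-t rho_i)]; the truncated [k - rho_i] is exact
     because [rho_i <= k]. *)
  rewrite -[X in _ < X]mul1r -ltr_pdivrMr ?exprn_gt0 // mulr_suml.
  apply: le_lt_trans lt1; apply: ler_sum => i _.
  rewrite natrX ler_pdivrMr ?exprn_gt0 // mulrC ler_pdivlMr ?exprn_gt0 //.
  by rewrite -exprD mulnBl [(t * _)%N]mulnC subnK // leq_mul2r rho_le_dim orbT.
apply: leq_trans (_ : (\dim <<X>> <= t)%N).
  by apply: crit_le => //; apply/span_subvP.
by rewrite -[X in (_ <= X)%N](size_tuple X) dim_span.
Qed.

Lemma t0_le t : (0 < t)%N -> (n < #|F| ^ (t * rho_min C))%N -> (t0 nd <= t)%N.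
Proof.
move=> t_gt0 lt_n; rewrite /t0; case: ex_minnP => m _; apply.
rewrite /t0_pred t_gt0 /=.
have q1 := finNzRing_gt1 F; have q0 := ltnW q1.
set Q := (#|F| ^ (t * rho_min C))%N in lt_n *.
have Q0 : (0 : rat) < Q%:R by rewrite ltr0n expn_gt0 q0.
(* Each term is at most [1/Q], so the sum is at most [n/Q < 1]. *)
apply: (@le_lt_trans _ _ (\sum_(i < n) (Q%:R : rat)^-1)).
  apply: ler_sum => i _; rewrite -natrX lef_pV2 ?posrE ?ltr0n ?expn_gt0 ?q0 //.
  by rewrite ler_nat leq_exp2l // leq_mul2l rho_min_le orbT.
rewrite sumr_const card_ord -[X in X < _]mulr_natl ltr_pdivrMr //.
by rewrite mul1r ltr_nat.
Qed.

Lemma t0_le_log (R : realType) : (0 < n)%N ->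
  (t0 nd)%:Z <= Num.floor (log_base (#|F|%:R : R) n%:R / (rho_min C)%:R) + 1.
Proof.
move=> n_gt0; set x := _ / _.
have q1 : (1 : R) < #|F|%:R by rewrite ltr1n finNzRing_gt1.
have q0 := lt_trans ltr01 q1.
have lnq : 0 < ln (#|F|%:R : R) by rewrite ln_gt0.
have r0 : (0 : R) < (rho_min C)%:R by rewrite ltr0n rho_min_gt0.
have x0 : 0 <= x.
  by rewrite divr_ge0 ?(ltW r0) ?divr_ge0 ?(ltW lnq) ?ln_ge0 ?ler1n.
(* This rules out a negative floor [m], so [m + 1] is a positive candidate for [t]. *)
have : 0 <= Num.floor x by rewrite floor_ge0.
have := floorD1_gt x; case: (Num.floor x) => // m lt_x _.
rewrite -PoszD addn1 lez_nat; apply: t0_le => //.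
(* Clearing denominators and removing [ln] turns [x < m + 1] into [n < q^((m + 1) rho_min)]. *)
move: lt_x; rewrite /x /log_base ltr_pdivrMr // ltr_pdivrMr //.
rewrite -PoszD addn1 -pmulrn -natrM mulr_natl -lnXn //.
by rewrite ltr_ln ?posrE ?exprn_gt0 ?q0 ?ltr0n // -natrX ltr_nat.
Qed.

End Critical.

Theorem proposition3p14 (R : realType) (q h n k : nat)
    (F : finFieldType) (L : fieldExtType F) (C : {vspace ambient L n})
    (hq : #|F| = q) (hL : \dim {: L} = h)
    (h_gt0 : (0 < h)%N) (n_gt0 : (0 < n)%N) (k_gt0 : (0 < k)%N)
    (dimC : \dim C = k) (nd : nondegenerate_code C) :
  [/\ Num.ceil (n%:R / (wmax C)%:R : R) <= (crit C)%:Z,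
      (crit C)%:Z <= Num.min (k%:Z - (rho_min C)%:Z + 1) (t0 nd)%:Z
    & Num.min (k%:Z - (rho_min C)%:Z + 1) (t0 nd)%:Z
      <= Num.min (k%:Z - (rho_min C)%:Z + 1)
           (Num.floor (log_base (q%:R : R) n%:R / (rho_min C)%:R) + 1) ].
Proof.
have le_n := length_le_crit nd; split.
(* A zero [wmax C] would force [n = 0] by [le_n]; positivity allows clearing the denominator. *)
- have w_gt0 : (0 < wmax C)%N.
    by rewrite lt0n; apply: contraTneq le_n => ->; lia.
  by rewrite ceil_le_int ler_pdivrMr ?ltr0n // -natrM ler_nat.
- rewrite le_min lez_nat crit_le_t0 andbT.
  by have := crit_le_dim nd n_gt0; have := rho_min_le_dim C n_gt0; lia.
- by rewrite le_min2 // -hq t0_le_log.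
Qed.
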